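(* For every fixed symmetric distribution function $g$, the class of $g$-weighted integral means of the first kind is minimal and complete. That is: (minimality) if $M_1,M_2$ are $g$-weighted integral means of the first kind with $Q_{M_1}=Q_{M_2}$, then $M_1=M_2$; (completeness) for every infinitely differentiable function $u:(0,+\infty)\to\mathbb{R}$ there exists a $g$-weighted integral mean of the first kind $M$ with $Q_M=u$.
   Context: A mean is a function $M:(0,+\infty)^2\to(0,+\infty)$ of class $C^\infty$ such that $\min(x,y)\le M(x,y)\le\max(x,y)$ and $M(x,y)=M(y,x)$ for all $x,y>0$. The characteristic function of a mean $M$ is $Q_M:(0,+\infty)\to\mathbb{R}$, $Q_M(x):=\frac{\partial^2 M}{\partial x^2}(x,x)$ (second partial derivative with respect to the first variable, evaluated at $(x,x)$). A function $g:[0,1]\to\mathbb{R}$ is a symmetric distribution function if: (i) $g\ge0$ almost everywhere on $[0,1]$; (ii) $g$ is Lebesgue-integrable on $[0,1]$ with $\int_0^1 g(t)\,dt=1$; (iii) $g(t)=g(1-t)$ for almost all $t\in[0,1]$. A $g$-weighted integral mean of the first kind is a mean of the form $M(x,y)=f^{-1}\left(\int_0^1 f\left(tx+(1-t)y\right)g(t)\,dt\right)$ for all $x,y>0$, where $f:(0,+\infty)\to\mathbb{R}$ is strictly monotonic and infinitely differentiable. *)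

(* Defs.v *)
From HB Require Import structures.
From mathcomp Require Import all_boot all_order all_algebra.
From mathcomp Require Import all_classical all_reals all_analysis.

Set Implicit Arguments.
Unset Strict Implicit.
Unset Printing Implicit Defensive.

Import Order.TTheory GRing.Theory Num.Theory.
Import numFieldNormedType.Exports.

Local Open Scope classical_set_scope.
Local Open Scope ring_scope.

(* A function on (0, +oo), on (0, +oo)^2 or on [0, 1] is represented by a total
   function of which only the restriction to that domain is ever constrained or
   compared; derivatives are taken at points of open domains, so they do not
   depend on the values outside. *)

Section smooth.
Context {R : realType}.

Definition smooth (f : R -> R) : Prop :=
  forall (n : nat) (x : R), 0 < x -> derivable (derive1n n f) x 1.

Definition quadrant : set (R * R) := [set p | 0 < p.1 /\ 0 < p.2].

(* class C^k on the open quadrant: the partial derivatives along the two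
   coordinate directions exist and are of class C^(k - 1) *)
Fixpoint class_C (k : nat) (F : R * R -> R) : Prop :=
  if k is k'.+1 then
    forall v : R * R, v \in [:: (1, 0); (0, 1)] ->
      (forall p, quadrant p -> derivable F p v) /\ class_C k' ('D_v F)
  else forall p, quadrant p -> {for p, continuous F}.

Definition smooth2 (F : R * R -> R) : Prop := forall k, class_C k F.

End smooth.

Section means.
Context {R : realType}.
Implicit Types (f g u : R -> R) (M : R * R -> R).

Definition is_mean M : Prop :=
  [/\ smooth2 M,
      forall x y : R, 0 < x -> 0 < y -> 0 < M (x, y),
      forall x y : R, 0 < x -> 0 < y ->
        Num.min x y <= M (x, y) <= Num.max x y &
      forall x y : R, 0 < x -> 0 < y -> M (x, y) = M (y, x)].

Definition char_fun M (x : R) : R := 'D_(1, 0) ('D_(1, 0) M) (x, x).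

Definition minimal_class (C : set (R * R -> R)) : Prop :=
  forall M1 M2, C M1 -> C M2 ->
    (forall x : R, 0 < x -> char_fun M1 x = char_fun M2 x) ->
    forall x y : R, 0 < x -> 0 < y -> M1 (x, y) = M2 (x, y).

Definition complete_class (C : set (R * R -> R)) : Prop :=
  forall u, smooth u ->
    exists2 M, C M & forall x : R, 0 < x -> char_fun M x = u x.

(* completed_lebesgue_measure lives on the sigma-algebra of Lebesgue measurable
   sets, whereas lebesgue_measure would force g to be Borel measurable *)
Local Notation mu := (@completed_lebesgue_measure R).

Definition symmetric_distribution g : Prop :=
  [/\ {ae mu, forall t, `[0, 1]%classic t -> 0 <= g t},
      mu.-integrable `[0, 1] (EFin \o g),
      (\int[mu]_(t in `[0, 1]) g t = 1)%R &
      {ae mu, forall t, `[0, 1]%classic t -> g t = g (1 - t)}].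

Definition strictly_monotonic f : Prop :=
  {in `]0, +oo[ &, {homo f : x y / x < y}} \/
  {in `]0, +oo[ &, {homo f : x y /~ x < y}}.

(* The integral lies between f x and f y, hence in the range of f on (0, +oo):
   the default value of the inverse is never used. *)
Definition weighted_integral_mean g : set (R * R -> R) :=
  [set M | is_mean M /\ exists f,
    [/\ strictly_monotonic f, smooth f &
        forall x y : R, 0 < x -> 0 < y ->
          M (x, y) = 'pinv_(fun=> 1) `]0, +oo[ f
            (\int[mu]_(t in `[0, 1]) (f (t * x + (1 - t) * y) * g t))%R]].

End means.

(* Main.v *)
From mathcomp Require Import all_boot all_order all_algebra.
From mathcomp Require Import all_classical all_reals all_analysis.
From mathcomp Require Import measurable_realfun.
From mathcomp Require Import ring lra.
Require Import Defs.

Set Implicit Arguments.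
Unset Strict Implicit.
Unset Printing Implicit Defensive.

Import Order.TTheory GRing.Theory Num.Theory.
Import numFieldNormedType.Exports.

Local Open Scope classical_set_scope.
Local Open Scope ring_scope.

(** The generator [f] of a weighted integral mean enters only through its
    derivative. Write [L phi] for the integral of [phi * g] over [0, 1]: a
    positive linear functional with [L 1 = 1], invariant under [t |-> 1 - t],
    hence with [L id = 1/2]; its variance [s := L ((t - 1/2)^2)] is positive,
    since otherwise [g] would vanish almost everywhere. Differentiating
    [f (M (x, y)) = L (fun t => f (t x + (1 - t) y))] twice in [x] at a diagonal
    point gives
      [f' x * Q_M x = s * f'' x]
    ([char_fun_generated], [generator_ode]). The characteristic function thus
    determines, and is determined by, the logarithmic derivative of [f'].

    Minimality. Fix a primitive [A] of [Q / s]. By the linear equation above,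
    any generator of a mean with characteristic function [Q] satisfies
    [f' = c * exp A] ([generator_exp]). Two generators are therefore affinely
    related, and since [L] is linear with [L 1 = 1], they define the same mean.

    Completeness. Given [u], take [A' = u / s] and [f' = exp A], so that [f] is
    smooth and increasing. The equation then gives [Q_M = u], once
    [M = f^-1 (L (f (t x + (1 - t) y)))] is known to be a mean, and the only
    difficulty is that [M] is smooth. Instead of differentiating [M]
    repeatedly, one exhibits an algebra of functions containing [M] and stable
    under directional derivatives ([mean_algebra]): it is generated by the
    functions [L (p(t) h(t x + (1 - t) y))] and [e o M]. Both kinds have
    derivatives of the same shape, because
    [D_v M = exp (- A o M) * D_v (f o M)].

    Differentiation under the integral needs no convergence theorem: [L] is
    bounded by the supremum norm, so the Taylor estimate of [h] on a compact
    interval integrates to one for [L (p(t) h(t x + (1 - t) y))]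
    ([wint_taylor]). *)

(** * Reflection invariance of the completed Lebesgue measure *)

Lemma integral_measure_preserving d (T : measurableType d) (R : realType)
    (mu : {measure set T -> \bar R}) (r : T -> T) (f : T -> \bar R) :
  measurable_fun setT r ->
  (forall A, measurable A -> mu (r @^-1` A) = mu A) ->
  measurable_fun setT f ->
  (\int[mu]_t f (r t) = \int[mu]_t f t)%E.
Proof.
move=> mr mur mf.
have ge0 (h : T -> \bar R) : measurable_fun setT h -> (forall t, 0 <= h t)%E ->
    (\int[mu]_t (h \o r) t = \int[mu]_t h t)%E.
  move=> mh h0; rewrite -[X in integral mu X](preimage_setT r).
  rewrite -(ge0_integral_pushforward mr)//.
  by apply: eq_measure_integral => A mA _; rewrite -mur.
rewrite integralE [RHS]integralE.
have := ge0 _ (measurable_funepos mf) (funepos_ge0 f).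
have := ge0 _ (measurable_funeneg mf) (funeneg_ge0 f).
by rewrite -funepos_comp -funeneg_comp => -> ->.
Qed.

Section reflection.
Context {R : realType}.
Local Notation mu := (@completed_lebesgue_measure R).
Local Notation leb := (@lebesgue_measure R).
Local Notation T := (caratheodory_type (@wlength R idfun)^*%mu).

Definition reflect01 (t : R) : R := 1 - t.

Lemma measurable_reflect01 :
  measurable_fun setT (reflect01 : measurableTypeR R -> measurableTypeR R).
Proof. exact: measurable_funB. Qed.

Lemma preimage_reflect01 (a b : bool) (x y : R) :
  reflect01 @^-1` [set` Interval (BSide a x) (BSide b y)] =
  [set` Interval (BSide (~~ b) (1 - y)) (BSide (~~ a) (1 - x))].
Proof.
apply/seteqP; split => t /=; rewrite /reflect01 !in_itv/=;
  case: a b => -[] /=; lra.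
Qed.

Lemma lebesgue_measure_reflect01 (A : set R) :
  measurable (A : set (measurableTypeR R)) ->
  leb (reflect01 @^-1` A) = leb A.
Proof.
move=> mA.
rewrite -[LHS]/(pushforward leb (reflect01 : _ -> measurableTypeR R) A).
apply/esym/lebesgue_measure_unique => //=; first exact: measurable_reflect01.
move=> ? _ [[a b]] _ <-.
rewrite /pushforward preimage_reflect01/= !lebesgue_measure_itv/=.
rewrite !lte_fin ltrD2l ltrN2 -!EFinB; case: ifP => // _; congr (_%:E); lra.
Qed.

Lemma measurable_completed (A : set R) :
  measurable (A : set (measurableTypeR R)) -> measurable (A : set T).
Proof. exact: sub_caratheodory. Qed.

Lemma completed_measureE (A : set R) :
  measurable (A : set (measurableTypeR R)) -> mu A = leb A.
Proof. by []. Qed.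

(** A set measurable for the completed measure is a Borel set up to a subset of
    a Borel null set; the invariance of the completed measure is reduced
    to Borel sets in this way. *)
Lemma completed_measurableP (A : set T) : measurable A ->
  exists X N Y : set R, [/\ measurable (X : set (measurableTypeR R)),
     measurable (Y : set (measurableTypeR R)), leb Y = 0%E, N `<=` Y &
       A = X `|` N].
Proof.
rewrite -[measurable A]/((@wlength R idfun)^*%mu.-cara.-measurable A).
rewrite -completed_caratheodory_measurable g_sigma_completed_algebra_genE.
move=> [X mX [N [Y [mY Y0 NY]]] <-].
by exists X, N, Y.
Qed.

Lemma completed_reflect01 (A : set T) : measurable A ->
  measurable (reflect01 @^-1` A : set T) /\ mu (reflect01 @^-1` A) = mu A.
Proof.
move=> mA; have [X [N [Y [mX mY Y0 NY AE]]]] := completed_measurableP mA.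
have mr B : measurable (B : set (measurableTypeR R)) ->
    measurable (reflect01 @^-1` B : set (measurableTypeR R)).
  by move=> mB; rewrite -[X in measurable X]setTI; exact: measurable_reflect01.
have mrX := mr _ mX; have mrY := mr _ mY.
have nullmu Z : (Z : set R) `<=` Y -> mu.-negligible (Z : set T).
  by move=> ZY; exists Y; split => //; exact: measurable_completed.
have nullmu' Z : (Z : set R) `<=` reflect01 @^-1` Y ->
  mu.-negligible (Z : set T).
  move=> ZY; exists (reflect01 @^-1` Y); split => //;
    first exact: measurable_completed.
  by rewrite completed_measureE// lebesgue_measure_reflect01.
have muU (B Z : set T) : measurable B -> mu.-negligible Z ->
   measurable (B `|` Z) /\ mu (B `|` Z) = mu B.
  move=> mB nZ; have mZ := completed_lebesgue_measure_is_complete nZ.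
  split; first exact: measurableU.
  apply/eqP; rewrite eq_le; apply/andP; split.
    rewrite (le_trans (measureU2 _ _ _))// (measure_negligible mZ nZ) adde0//.
  by apply: le_measure; rewrite ?inE//; apply: measurableU.
rewrite AE {A AE mA} preimage_setU.
have [? ->] := muU X N (measurable_completed mX) (nullmu _ NY).
have [? ->] := muU _ (reflect01 @^-1` N) (measurable_completed mrX) (nullmu' _
  (preimage_subset NY)).
by split => //; rewrite !completed_measureE// lebesgue_measure_reflect01.
Qed.

Lemma measurable_completed_reflect01 : measurable_fun setT (reflect01 : T -> T).
Proof. by move=> _ A mA; rewrite setTI; have [] := completed_reflect01 mA. Qed.

End reflection.

(** * Integration against a nonnegative weight *)

Section weighted_integral.
Context d (T : measurableType d) (R : realType).
Variables (mu : {measure set T -> \bar R}) (D : set T) (g : T -> R).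
Hypothesis mD : measurable D.
Hypothesis gi : mu.-integrable D (EFin \o g).

Lemma integrable_bounded_weight (phi : T -> R) :
  measurable_fun D phi -> [bounded phi t | t in D] ->
  mu.-integrable D (EFin \o (fun t => phi t * g t)).
Proof. by move=> mphi bphi; have := integrableMr mD mphi bphi gi. Qed.

Hypothesis g0 : {ae mu, forall t, D t -> 0 <= g t}.

(** An integrand that is nonnegative everywhere, rather than almost everywhere,
    makes the pointwise positivity of the integral applicable. *)
Lemma Rintegral_weight_norm (phi : T -> R) :
  measurable_fun D phi -> [bounded phi t | t in D] ->
  \int[mu]_(t in D) (phi t * g t) = \int[mu]_(t in D) (phi t * `|g t|).
Proof.
move=> mphi bphi; congr fine; have mg := measurable_int _ gi.
have mg' : measurable_fun D g by exact/measurable_EFinP.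
apply: ae_eq_integral => //.
- exact/measurable_EFinP/measurable_funM.
- exact/measurable_EFinP/measurable_funM/measurableT_comp.
- by apply: filterS g0 => t gt Dt; rewrite /= ger0_norm// gt.
Qed.

Lemma Rintegral_weight_ge0 (phi : T -> R) :
  measurable_fun D phi -> [bounded phi t | t in D] ->
  (forall t, D t -> 0 <= phi t) -> 0 <= \int[mu]_(t in D) (phi t * g t).
Proof.
move=> mphi bphi phi0; rewrite Rintegral_weight_norm//.
by apply: Rintegral_ge0 => t Dt; rewrite mulr_ge0// phi0.
Qed.

(** If the integral vanished, so would [phi * g], hence [g], almost
    everywhere. *)
Lemma Rintegral_weight_gt0 (phi : T -> R) :
  measurable_fun D phi -> [bounded phi t | t in D] ->
  (forall t, D t -> 0 <= phi t) -> {ae mu, forall t, D t -> phi t != 0} ->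
  \int[mu]_(t in D) g t != 0 -> 0 < \int[mu]_(t in D) (phi t * g t).
Proof.
move=> mphi bphi phi0 phiN0; rewrite lt0r Rintegral_weight_ge0// andbT.
apply: contra_neq => I0; have mg := measurable_int _ gi.
have mg' : measurable_fun D g by exact/measurable_EFinP.
have mpg : measurable_fun D (fun t => (phi t * g t)%:E).
  exact/measurable_EFinP/measurable_funM.
have phig0 : ae_eq mu D (fun t => (phi t * g t)%:E) (cst 0%E).
  apply/(ae_eq_integral_abs _ mD mpg).
  have pgi := integrable_bounded_weight mphi bphi.
  have -> : (\int[mu]_(t in D) `|(phi t * g t)%:E| = \int[mu]_(t in D) (phi t *
    g t)%:E)%E.
    apply: ae_eq_integral => //; first exact: measurableT_comp.
    apply: filterS g0 => t gt Dt.
    by rewrite gee0_abs// lee_fin mulr_ge0 ?phi0 ?gt.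
  by rewrite -[LHS]fineK ?(integrable_fin_num _ pgi)//; congr EFin.
rewrite /Rintegral (ae_eq_integral (cst 0%E))// ?integral0//.
apply: filterS2 phig0 phiN0 => t pg pn Dt.
have := pg Dt => -[] /eqP; rewrite mulf_eq0 (negbTE (pn Dt))/= => /eqP.
by move=> ->.
Qed.

Lemma Rintegral_weight_symmetric (r : T -> T) (phi : T -> R) :
  measurable_fun setT r ->
  (forall A, measurable A -> mu (r @^-1` A) = mu A) ->
  (forall t, D (r t) <-> D t) ->
  {ae mu, forall t, D t -> g t = g (r t)} ->
  measurable_fun D phi -> measurable_fun D (phi \o r) ->
  \int[mu]_(t in D) (phi (r t) * g t) = \int[mu]_(t in D) (phi t * g t).
Proof.
move=> mr mur rD gr mphi mphir; have mg := measurable_int _ gi.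
have mg' : measurable_fun D g by exact/measurable_EFinP.
have mpg : measurable_fun D (fun t => (phi t * g t)%:E).
  exact/measurable_EFinP/measurable_funM.
have mpg' := proj1 (measurable_restrictT _ mD) mpg.
congr fine; rewrite [RHS]integral_mkcond -(integral_measure_preserving mr mur
  mpg').
rewrite [LHS]integral_mkcond; apply: ae_eq_integral => //.
- apply/(measurable_restrictT _ mD)/measurable_EFinP/measurable_funM => //.
- exact: measurableT_comp mr.
apply: filterS gr => t gt _; rewrite /patch.
have -> : (r t \in D) = (t \in D) by apply/idP/idP; rewrite !inE => /rD.
by case: ifPn => //; rewrite inE => /gt ->.
Qed.

End weighted_integral.

(** * The functional attached to a symmetric distribution function *)

Section weight01.
Context {R : realType}.
Local Notation mu := (@completed_lebesgue_measure R).
Local Notation T := (caratheodory_type (@wlength R idfun)^*%mu).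
Implicit Types phi psi : R -> R.

(** Continuity is required two-sidedly at the end points, so that it passes
    directly to compositions; the integrands of interest are defined near
    [0, 1]. *)
Definition cont01 phi := {in `[0, 1], forall t, {for t, continuous phi}}.

Lemma cont01_measurable phi : cont01 phi ->
  measurable_fun (`[0, 1]%classic : set T) (phi : T -> R).
Proof.
move=> cphi mD B mB; apply: measurable_completed.
have : measurable_fun (`[0,1]%classic : set (measurableTypeR R)) phi.
  apply: subspace_continuous_measurable_fun => //.
  by apply: continuous_in_subspaceT => t; rewrite inE => t01; exact: cphi.
by apply => //; exact: measurable_itv.
Qed.

Lemma cont01_bounded phi : cont01 phi -> [bounded phi t | t in `[0, 1]%classic].
Proof.
move=> cphi.
have := @compact_bounded _ _ (phi @` `[0,1]) _.
case.
  apply: continuous_compact; last exact: segment_compact.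
  by apply: continuous_in_subspaceT => t; rewrite inE => t01; exact: cphi.
move=> M [Mr MP]; exists M; split => // x Mx t t01; apply: (MP x Mx).
by exists t.
Qed.

Lemma measurable01 : measurable (`[0, 1]%classic : set T).
Proof. apply: measurable_completed; exact: measurable_itv. Qed.

Lemma cont01_cst (c : R) : cont01 (cst c).
Proof. by move=> t _; exact: cvg_cst. Qed.

Lemma cont01D phi psi : cont01 phi -> cont01 psi -> cont01 (fun t =>
  phi t + psi t).
Proof. by move=> cp cs t t01; apply: continuousD; [exact: cp|exact: cs]. Qed.

Lemma cont01M phi psi : cont01 phi -> cont01 psi -> cont01 (fun t =>
  phi t * psi t).
Proof. by move=> cp cs t t01; apply: continuousM; [exact: cp|exact: cs]. Qed.

Lemma cont01_id : cont01 id.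
Proof. by move=> t _; exact: cvg_id. Qed.

Lemma cont01_reflect01 : cont01 reflect01.
Proof. by move=> t _; apply: continuousB; [exact: cvg_cst|exact: cvg_id]. Qed.

Lemma reflect01_in t : (reflect01 t \in `[0, 1]) = (t \in `[0, 1 : R]).
Proof. rewrite /reflect01 !in_itv/=; lra. Qed.

Lemma cont01_comp_reflect01 phi : cont01 phi -> cont01 (phi \o reflect01).
Proof.
move=> cp t t01; apply: continuous_comp; first exact: cont01_reflect01.
by apply: cp; rewrite reflect01_in.
Qed.

Variable g : R -> R.
Hypothesis hg : symmetric_distribution g.

Definition wmean phi : R := \int[mu]_(t in `[0, 1]) (phi t * g t).

Lemma wmean_integrable phi : cont01 phi ->
  mu.-integrable (`[0, 1]%classic : set T) (EFin \o (fun t => phi t * g t)).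
Proof.
have [_ gi _ _] := hg; move=> cp.
exact: (integrable_bounded_weight measurable01 gi (cont01_measurable cp)
  (cont01_bounded cp)).
Qed.

Lemma eq_wmean phi psi : {in `[0, 1], phi =1 psi} -> wmean phi = wmean psi.
Proof. by move=> e; apply: eq_Rintegral => t; rewrite inE => /e ->. Qed.

Lemma wmeanD phi psi : cont01 phi -> cont01 psi ->
  wmean (fun t => phi t + psi t) = wmean phi + wmean psi.
Proof.
move=> cp cs; rewrite /wmean -RintegralD//; last 3 first.
  exact: measurable01. exact: wmean_integrable. exact: wmean_integrable.
by apply: eq_Rintegral => t _; rewrite mulrDl.
Qed.

Lemma wmeanZ c phi : cont01 phi -> wmean (fun t => c * phi t) = c * wmean phi.
Proof.
move=> cp; rewrite /wmean -RintegralZl//; last 2 first.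
  exact: measurable01. exact: wmean_integrable.
by apply: eq_Rintegral => t _; rewrite mulrA.
Qed.

Lemma wmean_cst c : wmean (cst c) = c.
Proof.
have [_ gi g1 _] := hg; rewrite -[c in LHS]mulr1 (wmeanZ _ (@cont01_cst 1))
  /wmean.
by under eq_Rintegral do rewrite mul1r; rewrite g1 mulr1.
Qed.

Lemma wmean_ge0 phi : cont01 phi -> {in `[0, 1], forall t, 0 <= phi t} ->
  0 <= wmean phi.
Proof.
have [g0 gi _ _] := hg; move=> cp p0.
exact: (Rintegral_weight_ge0 measurable01 gi g0 (cont01_measurable cp)
  (cont01_bounded cp) p0).
Qed.

Lemma wmean_le phi psi : cont01 phi -> cont01 psi ->
  {in `[0, 1], forall t, phi t <= psi t} -> wmean phi <= wmean psi.
Proof.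
move=> cp cs le; have cN := cont01M (@cont01_cst (-1)) cp.
rewrite -subr_ge0 -mulN1r -(wmeanZ _ cp) -(wmeanD cs cN).
apply: (wmean_ge0 (cont01D cs cN)) => t t01.
by rewrite mulN1r subr_ge0 le.
Qed.

Lemma wmean_norm_le K phi : cont01 phi ->
  {in `[0, 1], forall t, `|phi t| <= K} ->
  `|wmean phi| <= K.
Proof.
move=> cp le.
have lb : wmean (cst (- K)) <= wmean phi.
  by apply: (wmean_le (@cont01_cst _) cp) => t /le;
    rewrite ler_norml => /andP[].
have ub : wmean phi <= wmean (cst K).
  by apply: (wmean_le cp (@cont01_cst _)) => t /le;
    rewrite ler_norml => /andP[].
by rewrite !wmean_cst in lb ub; rewrite ler_norml lb.
Qed.

Lemma wmean_reflect01 phi : cont01 phi -> wmean (phi \o reflect01) = wmean phi.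
Proof.
have [g0 gi _ gs] := hg; move=> cp.
have r01 (t : T) : (`[0, 1]%classic : set T) (reflect01 t) <-> `[0, 1]%classic
  t.
  by have /= -> := reflect01_in t.
exact: (@Rintegral_weight_symmetric _ _ _ mu _ _ measurable01 gi reflect01 phi
  measurable_completed_reflect01 (fun A mA => (completed_reflect01 mA).2) r01 gs
  (cont01_measurable cp) (cont01_measurable (cont01_comp_reflect01 cp))).
Qed.

Lemma wmean_id : wmean id = 1 / 2.
Proof.
have := wmean_reflect01 cont01_id.
have -> : wmean (id \o reflect01) = wmean (cst 1) + wmean (fun t => -1 * t).
  rewrite -(wmeanD (@cont01_cst 1) (cont01M (@cont01_cst (-1)) cont01_id)).
  by apply: eq_wmean => t _ /=; rewrite mulN1r.
rewrite wmean_cst (wmeanZ _ cont01_id); lra.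
Qed.

Definition wvar : R := wmean (fun t => (t - 1 / 2) ^+ 2).

Lemma cont01_variance : cont01 (fun t => (t - 1 / 2) ^+ 2).
Proof.
have := cont01D cont01_id (@cont01_cst (- (1/2))) => c; exact: (cont01M c c).
Qed.

(** A Lebesgue density cannot concentrate its mass at the point 1/2. *)
Lemma wvar_gt0 : 0 < wvar.
Proof.
have [g0 gi g1 _] := hg.
have half0 : {ae mu, forall t, (`[0, 1]%classic : set T) t ->
  (t - 1 / 2) ^+ 2 != 0}.
  exists [set (1 / 2 : R)]; split.
  - exact: measurable_completed (measurable_set1 _).
  - by rewrite completed_measureE ?lebesgue_measure_set1.
  - move=> t /= /not_implyP[_] /negP.
    by rewrite negbK sqrf_eq0 subr_eq0 => /eqP.
have g1N0 : \int[mu]_(t in `[0, 1]) g t != 0 by rewrite g1 oner_neq0.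
exact: (@Rintegral_weight_gt0 _ _ _ mu _ _ measurable01 gi g0 _
  (cont01_measurable cont01_variance) (cont01_bounded cont01_variance)
  (fun t _ => sqr_ge0 _) half0 g1N0).
Qed.

Lemma wvarE : wmean (fun t => t * t) = wvar + 1 / 4.
Proof.
have cN := cont01M (@cont01_cst (-1)) cont01_id.
have c4 := @cont01_cst (1 / 4).
have c2 := cont01M cont01_id cont01_id.
have -> : wvar = wmean (fun t => t * t) + (wmean (fun t =>
  -1 * t) + wmean (cst (1/4))).
  rewrite -(wmeanD cN c4) -(wmeanD c2 (cont01D cN c4)).
  by apply: eq_wmean => t _ /=; field.
rewrite wmean_cst (wmeanZ _ cont01_id) wmean_id; lra.
Qed.

End weight01.

(** * Smooth functions and linear differential equations on the half line *)

Section half_line.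
Context {R : realType}.
Implicit Types (f u A : R -> R) (x y : R).

Lemma near_pos x : 0 < x -> \forall y \near x, 0 < y.
Proof. exact: lt_nbhsr. Qed.

Lemma is_derive_derive1 f x l : is_derive x 1 f l -> derive1 f x = l.
Proof. by move=> [_ <-]; rewrite derive1E. Qed.

Lemma derivable_is_derive1 f x : derivable f x 1 ->
  is_derive x 1 f (derive1 f x).
Proof. by move=> df; apply: DeriveDef; rewrite -?derive1E. Qed.

Lemma is_derive_continuous f x l : is_derive x 1 f l -> {for x, continuous f}.
Proof. by move=> [df _]; apply/differentiable_continuous/derivable1_diffP. Qed.

Lemma within_half_line f a b : 0 < a -> (forall x, 0 < x ->
  {for x, continuous f}) ->
  {within `[a, b], continuous f}.
Proof.
move=> a0 cf; apply: continuous_in_subspaceT => x;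
  rewrite inE/= in_itv/= => /andP[ax _].
by apply: cf; exact: lt_le_trans ax.
Qed.

(** A set of functions that is stable under differentiation on the half line,
    up to values outside of it, consists of smooth functions. Smoothness is
    thus proved by giving a stable set, without formulas for the higher
    derivatives. *)
Lemma smooth_coind (P : (R -> R) -> Prop) :
  (forall f, P f -> exists2 f1, P f1 & forall x, 0 < x ->
    is_derive x 1 f (f1 x)) ->
  forall f, P f -> smooth f.
Proof.
move=> HP f Pf n; have : exists2 f0, P f0 & forall x, 0 < x ->
  f x = f0 x by exists f.
elim: n f {Pf} => [|n IH] f [f0 Pf0 ff0] x x0; have [f1 Pf1 df0] := HP _ Pf0.
  have [dd _] := df0 x x0; apply: near_eq_derivable _ dd.
  by apply: filterS (near_pos x0) => y y0; exact/esym/ff0.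
rewrite derive1Sn; apply: IH => //; exists f1 => // y y0.
apply: is_derive_derive1; apply: near_eq_is_derive _ (df0 y y0).
by apply: filterS (near_pos y0) => z z0; exact/esym/ff0.
Qed.

Lemma smooth_derivable f x : smooth f -> 0 < x -> derivable f x 1.
Proof. by move=> sf; exact: (sf 0%N). Qed.

Lemma smooth_is_derive f x : smooth f -> 0 < x -> is_derive x 1 f (derive1 f x).
Proof. by move=> sf x0; exact/derivable_is_derive1/smooth_derivable. Qed.

Lemma smooth_derive1 f : smooth f -> smooth (derive1 f).
Proof. by move=> sf n x; rewrite -derive1Sn; exact: sf. Qed.

Lemma smooth_continuous f x : smooth f -> 0 < x -> {for x, continuous f}.
Proof.
by move=> sf x0; apply: is_derive_continuous (smooth_is_derive sf x0).
Qed.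

Lemma smooth_primitive f u : smooth u ->
  (forall x, 0 < x -> is_derive x 1 f (u x)) -> smooth f.
Proof.
move=> su fu; apply: (@smooth_coind (fun h => h = f \/ smooth h)); last by left.
move=> h [->|sh]; first by exists u => //; right.
exists (derive1 h); first by right; exact: smooth_derive1.
by move=> x; exact: smooth_is_derive.
Qed.

(** The algebra generated by [exp o A] and the smooth functions is stable under
    differentiation, since [(exp o A)' = (exp o A) * A']. *)
Inductive exp_algebra (A : R -> R) : (R -> R) -> Prop :=
| exp_algebra_smooth f : smooth f -> exp_algebra A f
| exp_algebra_exp : exp_algebra A (expR \o A)
| exp_algebraD f1 f2 : exp_algebra A f1 -> exp_algebra A f2 ->
  exp_algebra A (f1 + f2)
| exp_algebraM f1 f2 : exp_algebra A f1 -> exp_algebra A f2 ->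
  exp_algebra A (f1 * f2).

Lemma smooth_exp_algebra A f : smooth A -> exp_algebra A f -> smooth f.
Proof.
move=> sA; apply: smooth_coind => {}f;
  elim => [{}f sf||f1 f2 A1 [g1 B1 d1] A2 [g2 B2 d2]
    |f1 f2 A1 [g1 B1 d1] A2 [g2 B2 d2]].
- exists (derive1 f); first by apply: exp_algebra_smooth; exact: smooth_derive1.
  by move=> x; exact: smooth_is_derive.
- exists ((expR \o A) * (derive1 A)).
    apply: exp_algebraM; first exact: exp_algebra_exp.
    by apply: exp_algebra_smooth; exact: smooth_derive1.
  by move=> x x0; apply: is_derive1_comp; exact: smooth_is_derive.
- exists (g1 + g2); first exact: exp_algebraD.
  by move=> x x0; apply: is_deriveD; [exact: d1|exact: d2].
- exists (f1 * g2 + f2 * g1); first by apply: exp_algebraD; exact: exp_algebraM.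
  by move=> x x0; apply: is_deriveM; [exact: d1|exact: d2].
Qed.

Lemma smooth_cst (c : R) : smooth (cst c : R -> R).
Proof.
apply: (@smooth_coind (fun h => exists c, h = cst c)); last by exists c.
by move=> _ [d ->]; exists (cst 0); [exists 0|move=> x _; exact: is_derive_cst].
Qed.

Lemma smoothM f1 f2 : smooth f1 -> smooth f2 -> smooth (f1 * f2).
Proof.
move=> s1 s2; apply: (smooth_exp_algebra (@smooth_cst 0)).
by apply: exp_algebraM; exact: exp_algebra_smooth.
Qed.

Lemma smooth_exp A : smooth A -> smooth (expR \o A).
Proof.
by move=> sA; apply: (smooth_exp_algebra sA); exact: exp_algebra_exp.
Qed.

Lemma smoothN f : smooth f -> smooth (- f).
Proof.
move=> sf; have -> : - f = cst (-1) * f by apply/funext => x;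
  rewrite fctE mulN1r.
by apply: smoothM => //; exact: smooth_cst.
Qed.

Lemma derive0_cst f : (forall x, 0 < x -> is_derive x 1 f 0) ->
  forall x y, 0 < x -> 0 < y -> f x = f y.
Proof.
move=> f0 x y x0 y0; wlog xy : x y x0 y0 / x <= y.
  by move=> h; have [/h->|/ltW/h->] := leP x y.
have cf : forall z, 0 < z -> {for z, continuous f}.
  by move=> z /f0; exact: is_derive_continuous.
have [|c _] := @MVT_segment _ f (cst 0) _ _ xy _ (within_half_line x0 cf).
  move=> z; rewrite in_itv/= => /andP[xz _]; apply: f0; exact: lt_trans xz.
by rewrite mul0r => /subr0_eq.
Qed.

(** The base point 1 of a primitive may lie on either side of [x], so the
    integral is taken from a point [a] below both, as
    [int_a^x u - int_a^1 u]; this is independent of [a]. *)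
Lemma primitive_exists u : (forall x, 0 < x -> {for x, continuous u}) ->
  exists A, forall x, 0 < x -> is_derive x 1 A (u x).
Proof.
move=> cu; pose I a x := \int[lebesgue_measure]_(t in `[a, x]) u t.
have intu a b : 0 < a -> lebesgue_measure.-integrable `[a, b] (EFin \o u).
  move=> a0; apply: continuous_compact_integrable; first exact: segment_compact.
  exact: within_half_line.
have IB a b x : 0 < a -> a <= b -> b <= x -> I a x - I a b = I b x.
  move=> a0 ab bx; rewrite /I Rintegral_itvB ?bnd_simp//; last exact: intu.
  rewrite Rintegral_itv_obnd_cbnd//.
  apply: integrableS (intu b x (lt_le_trans a0 ab)) => //.
  by apply: subset_itvr; rewrite bnd_simp.
pose A x := let a := Num.min x 1 / 2 in I a x - I a 1.
have A_indep a x : 0 < a -> a <= Num.min x 1 / 2 -> A x = I a x - I a 1.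
  move=> a0 am; rewrite /A; set b := _ / 2 in am *.
  have bx : b <= x /\ b <= 1 by move: am; rewrite /b; case: (leP x 1); lra.
  have [bx1 bx2] := bx.
  by rewrite -(IB a b x)// -(IB a b 1)// opprB addrA subrK.
(* a quarter of the minimum is an admissible [a] for every point beyond
   [x / 2], so that [A] has this single expression near [x] *)
exists A => x x0; pose a := Num.min x 1 / 4.
have a0 : 0 < a by rewrite /a divr_gt0// lt_min x0 ltr01.
have ax : a < x by move: a0; rewrite /a; case: (leP x 1); lra.
have dI : is_derive x 1 (fun y => I a y - I a 1) (u x).
  have x1 : x < x + 1 by rewrite ltrDl.
  have [dI I1] := continuous_FTC1_closed x1 (intu _ _ a0) ax (cu x x0).
  rewrite -[u x]subr0; apply: is_deriveB.
  by rewrite -I1; exact: derivable_is_derive1.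
apply: near_eq_is_derive _ dI.
have : \forall y \near x, x / 2 < y by apply: lt_nbhsr; lra.
apply: filterS => y xy; apply/esym/A_indep => //.
rewrite /a; case: (leP x 1); case: (leP y 1); lra.
Qed.

(** The derivative of [h * exp (- A)] vanishes. *)
Lemma linear_ode (h q A : R -> R) :
  (forall x, 0 < x -> is_derive x 1 A (q x)) ->
  (forall x, 0 < x -> is_derive x 1 h (h x * q x)) ->
  exists c, forall x, 0 < x -> h x = c * expR (A x).
Proof.
move=> dA dh; exists (h 1 * expR (- A 1)) => x x0.
have dE y : 0 < y -> is_derive y 1 (h * (expR \o (- A))) 0.
  move=> y0; have d1 := dA y y0; have d2 := dh y y0.
  have d3 : is_derive y 1 (expR \o (- A)) (expR (- A y) * - q y).
    by apply: is_derive1_comp.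
  apply: is_derive_eq; rewrite /= /GRing.scale/=; ring.
have := derive0_cst dE x0 ltr01.
rewrite /= !fctE => <-; rewrite -mulrA -expRD addrC subrr expR0 mulr1 //.
Qed.

Lemma smooth_lipschitz f a b : smooth f -> 0 < a ->
  exists K, {in `[a, b] &, forall x y, `|f x - f y| <= K * `|x - y|}.
Proof.
move=> sf a0; have [ab|ba] := leP a b; last first.
  by exists 0 => x y; rewrite in_itv/=; lra.
have cdf : {within `[a, b], continuous (fun z => `|derive1 f z|)}.
  apply: within_half_line => // z z0; apply: continuous_comp;
    last exact: norm_continuous.
  exact: smooth_continuous (smooth_derive1 sf) z0.
have [c cab cmax] := EVT_max ab cdf; exists `|derive1 f c| => x y xab yab.
wlog xy : x y xab yab / x <= y.
  move=> h; have [/h->//|/ltW/h] := leP x y.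
  by rewrite distrC [`|y - x|]distrC; apply.
have x0 : 0 < x by move: xab; rewrite in_itv/=; lra.
have cf : forall z, 0 < z -> {for z, continuous f} by move=> z;
  exact: smooth_continuous.
have [|z zab] := @MVT_segment _ f (derive1 f) _ _ xy _ (within_half_line x0 cf).
  move=> z; rewrite in_itv/= => /andP[xz _]; apply: smooth_is_derive => //;
    exact: lt_trans xz.
rewrite distrC [`|x - y|]distrC => ->; rewrite normrM ler_wpM2r//; apply: cmax.
by move: xab yab zab; rewrite !in_itv/=; lra.
Qed.

(** The weak form of the remainder, without the factor 1/2, suffices and
    follows from the mean value theorem and a Lipschitz bound for [f']. *)
Lemma smooth_taylor f a b : smooth f -> 0 < a ->
  exists K, {in `[a, b] &, forall x y,
    `|f y - f x - derive1 f x * (y - x)| <= K * (y - x) ^+ 2}.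
Proof.
move=> sf a0; have [K HK] := smooth_lipschitz b (smooth_derive1 sf) a0.
exists K => x y xab yab.
have cf : forall z, 0 < z -> {for z, continuous f} by move=> z;
  exact: smooth_continuous.
have [c cab fE] : exists2 c, c \in `[Num.min x y, Num.max x y] &
    f y - f x = derive1 f c * (y - x).
  have dfz (s t : R) : 0 < s -> forall z : R, z \in `]s, t[ ->
    is_derive z 1 f (derive1 f z).
    by move=> s0 z; rewrite in_itv/= => /andP[sz _];
      apply: smooth_is_derive => //; exact: lt_trans sz.
  have x0 : 0 < x by move: xab; rewrite in_itv/=; lra.
  have y0 : 0 < y by move: yab; rewrite in_itv/=; lra.
  have [xy|/ltW yx] := leP x y.
    exact: MVT_segment xy (dfz _ _ x0) (within_half_line x0 cf).
  have [c cab cE] := MVT_segment yx (dfz _ _ y0) (within_half_line y0 cf).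
  by exists c => //; rewrite -opprB cE -mulrN opprB.
rewrite fE -mulrBl normrM.
have cI : c \in `[a, b].
  by move: xab yab cab; rewrite !in_itv/=; case: (leP x y); lra.
rewrite -real_normK ?num_real// expr2 mulrA ler_wpM2r//.
apply: le_trans (HK _ _ cI xab) _.
have cx : `|c - x| <= `|y - x|.
  by move: cab; rewrite in_itv/=; case: (leP x y) => xy /andP[c1 c2];
    rewrite ler_norml; have := ler_norm (y - x); have := ler_norm (x - y);
      rewrite distrC; lra.
have K0 : 0 <= K * `|c - x| := le_trans (normr_ge0 _) (HK _ _ cI xab).
(* a nonzero increment is needed to see that [K] is nonnegative *)
have [->|cNx] := eqVneq c x.
  rewrite subrr normr0 mulr0; have [->|xNy] := eqVneq y x;
    first by rewrite subrr normr0 mulr0.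
  apply: mulr_ge0 => //.
  have := le_trans (normr_ge0 _) (HK _ _ yab xab).
  by rewrite pmulr_lge0// normr_gt0 subr_eq0.
apply: ler_wpM2l => //.
by move: K0; rewrite pmulr_lge0// normr_gt0 subr_eq0.
Qed.

End half_line.

(** * Directional derivatives on the quadrant *)

Section directional.
Context {R : realType}.

Lemma is_derive_quadratic (V : normedModType R) (H : V -> R) (q v : V)
    (l C : R) :
  (\forall s \near 0, `|H (s *: v + q) - H q - s * l| <= C * s ^+ 2) ->
  is_derive q v H l.
Proof.
move=> nearH.
have lim : h^-1 *: ((H \o shift q) (h *: v) - H q) @[h --> 0^'] --> l.
  apply/cvgrPdist_le => e e0.
  have d0 : 0 < e / (`|C| + 1) by rewrite divr_gt0// ltr_pwDr.
  have nears : \forall s \near (0 : R), `|s| < e / (`|C| + 1)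
    by exact: nbhs0_lt.
  near=> s.
  have s0 : s != 0 by near: s; exact: nbhs_dnbhs_neq.
  have sP : 0 < `|s| by rewrite normr_gt0.
  have -> : l - s^-1 *: ((H \o shift q) (s *: v) - H q) =
            - (s^-1 * (H (s *: v + q) - H q - s * l)).
    by rewrite /= /GRing.scale/= [in RHS]mulrBr mulKf// opprB.
  rewrite normrN normrM normfV ler_pdivrMl//.
  have sH : `|H (s *: v + q) - H q - s * l| <= C * s ^+ 2.
    by near: s; exact: nbhs_dnbhs.
  have se : `|s| < e / (`|C| + 1) by near: s; exact: nbhs_dnbhs.
  apply: (le_trans sH); rewrite -real_normK ?num_real// expr2 mulrCA
    ler_wpM2l//.
  move: se; rewrite ltr_pdivlMr ?ltr_pwDr// => /ltW; apply: le_trans.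
  by rewrite mulrC ler_wpM2l// (le_trans (ler_norm _))// lerDl.
by apply: DeriveDef; [exact: cvgP lim|exact: cvg_lim lim].
Unshelve. all: by end_near. Qed.

Lemma is_derive_along (V : normedModType R) (H : V -> R) (q v : V) (l : R) :
  is_derive q v H l <-> is_derive (0 : R) 1 (fun s : R => H (s *: v + q)) l.
Proof.
have E : (fun h : R => h^-1 *: ((H \o shift q) (h *: v) - H q)) =
    (fun h : R => h^-1 *:
      (((fun s : R => H (s *: v + q)) \o shift 0) (h *: 1) - H (0 *: v + q))).
  by apply/funext => h; rewrite /= addr0 [h *: 1]mulr1 scale0r add0r.
split => -[dH dE]; apply: DeriveDef.
- by rewrite /derivable/= -E.
- by rewrite /derive/= -E.
- by move: dH; rewrite /derivable/= -E.
- by move: dE; rewrite /derive/= -E.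
Qed.

Lemma is_derive_comp_along (V : normedModType R) (H : V -> R) (e : R -> R)
    (q v : V) (l m : R) :
  is_derive q v H l -> is_derive (H q) 1 e m -> is_derive q v (e \o H) (m * l).
Proof.
move=> /is_derive_along dH de; apply/is_derive_along.
apply: (@is_derive1_comp R e (fun s => H (s *: v + q))) => //.
by rewrite scale0r add0r.
Qed.

Lemma is_derive_fst (M : R * R -> R) (a b l : R) :
  is_derive (a, b) (1, 0) M l -> is_derive a 1 (fun s => M (s, b)) l.
Proof.
move=> /is_derive_along dM; apply/is_derive_along.
have -> // : (fun s : R => M (s *: 1 + a, b)) =
    (fun s : R => M (s *: (1, 0) + (a, b))).
by apply/funext => s; congr (M (_, _)); rewrite /= [s *: 0]mulr0 add0r.
Qed.

Lemma quadrant_near (q : R * R) : quadrant q -> \forall p \near q, quadrant p.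
Proof.
move=> [q1 q2]; exists ([set x | 0 < x], [set y | 0 < y]).
  by split; exact: near_pos.
by move=> p [].
Qed.

(** The analogue of [smooth_coind] on the quadrant, for directional derivatives
    up to values outside of the quadrant. *)
Lemma smooth2_coind (S : (R * R -> R) -> Prop) :
  (forall H, S H -> (forall q, quadrant q -> {for q, continuous H}) /\
    forall v : R * R, exists2 H1, S H1 & forall q, quadrant q ->
      is_derive q v H (H1 q)) ->
  forall H, S H -> smooth2 H.
Proof.
move=> HS H SH k; have : exists2 H0, S H0 & forall q, quadrant q ->
  H q = H0 q by exists H.
elim: k H {SH} => [|k IH] H [H0 S0 HH0] /=; have [c0 d0] := HS _ S0.
  move=> q qq; have := c0 q qq; rewrite /prop_for /continuous_at HH0//;
    apply: cvg_trans.
  apply: near_eq_cvg; apply: filterS (quadrant_near qq) => p qp; exact/esym/HH0.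
move=> v _; have [H1 S1 d1] := d0 v.
have d q : quadrant q -> is_derive q v H (H1 q).
  move=> qq; apply: near_eq_is_derive _ (d1 q qq).
  by apply: filterS (quadrant_near qq) => p qp; exact/esym/HH0.
split; first by move=> q /d[].
by apply: IH; exists H1 => // q /d[].
Qed.

End directional.

(** * Differentiation under the integral sign *)

Section weighted_mean_function.
Context {R : realType}.
Variable g : R -> R.
Hypothesis hg : symmetric_distribution g.
Implicit Types (p h : R -> R) (q w : R * R).

Definition bary q (t : R) : R := t * q.1 + (1 - t) * q.2.

(** The factor [p] allows for the powers of [t] and [1 - t] that
    differentiation brings out of [h (t x + (1 - t) y)]. *)
Definition wint p h q : R := wmean g (fun t => p t * h (bary q t)).

Lemma bary_gt0 q t : quadrant q -> t \in `[0, 1] -> 0 < bary q t.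
Proof.
move=> [q1 q2]; rewrite in_itv/= /bary => /andP[t0 t1].
have [->|tN0] := eqVneq t 0; first by rewrite mul0r add0r subr0 mul1r.
have tp : 0 < t by rewrite lt_neqAle eq_sym tN0.
by rewrite ltr_pwDl ?mulr_gt0// mulr_ge0 ?subr_ge0// ltW.
Qed.

Lemma bary_le q a b t : a <= q.1 <= b -> a <= q.2 <= b -> t \in `[0, 1] ->
  a <= bary q t <= b.
Proof. rewrite in_itv/= /bary; nra. Qed.

Lemma cont01_bary q : cont01 (bary q).
Proof.
exact: (cont01D (cont01M (@cont01_id R) (@cont01_cst _ q.1))
  (cont01M (@cont01_reflect01 R) (@cont01_cst _ q.2))).
Qed.

Lemma cont01_comp_bary h q : (forall z, 0 < z -> {for z, continuous h}) ->
  quadrant q ->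
  cont01 (h \o bary q).
Proof.
move=> ch qq t t01; apply: continuous_comp; first exact: cont01_bary.
by apply: ch; exact: bary_gt0.
Qed.

Lemma cont01_wint p h q : cont01 p -> smooth h -> quadrant q ->
  cont01 (fun t => p t * h (bary q t)).
Proof.
move=> cp sh qq; apply: (cont01M cp); apply: cont01_comp_bary => // z.
exact: smooth_continuous.
Qed.

Lemma baryD q w t : bary (w + q) t = bary q t + bary w t.
Proof. rewrite /bary /=; ring. Qed.

Lemma bary_norm w t : t \in `[0, 1] -> `|bary w t| <= `|w|.
Proof.
move=> t01; have w1 : `|w.1| <= `|w| by rewrite le_max lexx.
have w2 : `|w.2| <= `|w| by rewrite le_max lexx orbT.
rewrite ler_norml; apply: bary_le => //; by rewrite -ler_norml.
Qed.

(** Near [q] the points [bary (w + q) t] stay in a compact interval of the half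
    line, where [h] satisfies uniform Lipschitz and Taylor bounds with
    increments [bary w t] of size at most [`|w|]; the functional preserves
    these bounds. *)
Lemma wint_taylor p h q : quadrant q -> cont01 p ->
  smooth h -> exists C e, 0 < e /\ forall w, `|w| < e ->
   [/\ quadrant (w + q), `|wint p h (w + q) - wint p h q| <= C * `|w| &
    `|wint p h (w + q) - wint p h q -
      wint (fun t => p t * bary w t) (derive1 h) q| <= C * `|w| ^+ 2].
Proof.
move=> [q1 q2] cp sh; pose a := Num.min q.1 q.2 / 2;
  pose b := Num.max q.1 q.2 + a.
have a0 : 0 < a by rewrite /a divr_gt0// lt_min q1.
have [P [_ PP]] := cont01_bounded cp.
have {PP} Pp t : t \in `[0, 1] -> `|p t| <= `|P| + 1.
  by apply: PP; rewrite (le_lt_trans (ler_norm _))// ltrDl.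
have [K1 HK1] := smooth_lipschitz b sh a0.
have [K2 HK2] := smooth_taylor b sh a0.
pose C := (`|P| + 1) * (`|K1| + `|K2|).
exists C, a; split => // w wa.
have w1 : `|w.1| < a by apply: le_lt_trans wa; rewrite le_max lexx.
have w2 : `|w.2| < a by apply: le_lt_trans wa; rewrite le_max lexx orbT.
have zI : a <= q.1 <= b /\ a <= q.2 <= b.
  by move: a0; rewrite /b /a; case: (leP q.1 q.2); lra.
have zwI : a <= (w + q).1 <= b /\ a <= (w + q).2 <= b.
  by move: w1 w2; rewrite !ltr_norml /b /a /=; case: (leP q.1 q.2); lra.
have qq : quadrant q by [].
have qwq : quadrant (w + q) by split; lra.
have H1 t : t \in `[0, 1] -> bary q t \in `[a, b] /\ bary (w + q) t \in `[a, b].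
  by move=> t01; rewrite !in_itv/=; split; apply: bary_le => //; tauto.
have Bw t : t \in `[0, 1] -> `|bary w t| <= `|w| by exact: bary_norm.
have c1 := cont01_wint cp sh qwq.
have c2 := cont01_wint cp sh qq.
have c2' := cont01M (@cont01_cst R (-1)) c2.
have cpw := cont01M cp (@cont01_bary w).
have c3 := cont01_wint cpw (smooth_derive1 sh) qq.
have c3' := cont01M (@cont01_cst R (-1)) c3.
have PC : 0 <= `|P| + 1 by rewrite addr_ge0.
split=> //.
  have -> : wint p h (w + q) - wint p h q =
     wmean g (fun t => p t * h (bary (w + q) t) + -1 * (p t * h (bary q t))).
    by rewrite (wmeanD hg c1 c2') (wmeanZ hg _ c2) mulN1r.
  apply: (wmean_norm_le hg (cont01D c1 c2')) => t t01; have [I1 I2] := H1 t t01.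
  rewrite mulN1r -mulrBr normrM /C -mulrA ler_pM// ?Pp//.
  apply: (le_trans (HK1 _ _ I2 I1)); rewrite baryD addrC addKr.
  rewrite (le_trans (ler_norm _))// normrM normr_id ler_pM// ?Bw//.
  by rewrite lerDl.
have -> : wint p h (w + q) - wint p h q -
    wint (fun t => p t * bary w t) (derive1 h) q =
   wmean g (fun t => (p t * h (bary (w + q) t) + -1 * (p t * h (bary q t)))
      + -1 * (p t * bary w t * derive1 h (bary q t))).
  rewrite (wmeanD hg (cont01D c1 c2') c3') (wmeanD hg c1 c2') (wmeanZ hg _ c2).
  by rewrite (wmeanZ hg _ c3) !mulN1r.
apply: (wmean_norm_le hg (cont01D (cont01D c1 c2') c3')) => t t01.
have [I1 I2] := H1 t t01.
have -> : p t * h (bary (w + q) t) + -1 * (p t * h (bary q t)) +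
    -1 * (p t * bary w t * derive1 h (bary q t)) =
    p t * (h (bary (w + q) t) - h (bary q t) -
      derive1 h (bary q t) * (bary (w + q) t - bary q t)).
  by rewrite baryD; ring.
rewrite normrM /C -mulrA ler_pM// ?Pp//.
apply: (le_trans (HK2 _ _ I1 I2)); rewrite baryD addrAC subrr add0r.
rewrite (le_trans (ler_norm _))// normrM normrX ler_pM//.
  by rewrite lerDr.
by rewrite lerXn2r ?nnegrE// Bw.
Qed.

Lemma wint_continuous p h q : quadrant q -> cont01 p -> smooth h ->
  {for q, continuous (wint p h)}.
Proof.
move=> qq cp sh; have [C [e [e0 HC]]] := wint_taylor qq cp sh.
apply/cvgrPdist_le => eps eps0.
have d0 : 0 < Num.min e (eps / (`|C| + 1)).
  by rewrite lt_min e0 divr_gt0// ltr_pwDr.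
have : \forall p \near q, `|q - p| < Num.min e (eps / (`|C| + 1)).
  by have /cvgrPdist_lt := @cvg_id _ (nbhs q); apply.
apply: filterS => q'; rewrite lt_min distrC => /andP[/HC[_ + _] qe].
rewrite subrK => H; rewrite distrC; apply: le_trans H _.
move: qe; rewrite ltr_pdivlMr ?ltr_pwDr// mulrC => /ltW; apply: le_trans.
by rewrite ler_wpM2r// (le_trans (ler_norm _))// lerDl.
Qed.

Lemma wint_is_derive p h q v : quadrant q -> cont01 p -> smooth h ->
  is_derive q v (wint p h) (wint (fun t => p t * bary v t) (derive1 h) q).
Proof.
move=> qq cp sh; have [C [e [e0 HC]]] := wint_taylor qq cp sh.
apply: (@is_derive_quadratic _ _ _ _ _ _ (C * `|v| ^+ 2)).
have d0 : 0 < e / (`|v| + 1) by rewrite divr_gt0// ltr_pwDr.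
apply: filterS (nbhs0_lt d0) => s; rewrite ltr_pdivlMr ?ltr_pwDr// => se.
have sve : `|s *: v| < e.
  by rewrite normrZ (le_lt_trans _ se)// ler_wpM2l// lerDl.
have [_ _] := HC _ sve; rewrite normrZ exprMn real_normK ?num_real//.
have -> : wint (fun t => p t * bary (s *: v) t) (derive1 h) q =
    s * wint (fun t => p t * bary v t) (derive1 h) q.
  rewrite /wint -(wmeanZ hg); last first.
    exact: (cont01_wint (cont01M cp (@cont01_bary v)) (smooth_derive1 sh)).
  by apply: eq_wmean => t _; rewrite /bary /= /GRing.scale/=; ring.
by rewrite [s ^+ 2 * _]mulrC mulrA.
Qed.

End weighted_mean_function.

(** * The differential equation of a generator *)

Section quasi_arithmetic.
Context {R : realType}.
Variable g : R -> R.
Hypothesis hg : symmetric_distribution g.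
Implicit Types (f : R -> R) (M : R * R -> R).

(** The defining formula of the mean, with [f] applied to both sides to avoid
    its inverse. *)
Definition generates f M := forall q : R * R, quadrant q ->
  0 < M q /\ f (M q) = wint g (cst 1) f q.

Lemma strictly_monotonic_inj f : strictly_monotonic f ->
  {in `]0, +oo[ &, injective f}.
Proof.
move=> mf x y x0 y0 fxy; apply/eqP; case: (ltgtP x y) => // xy.
  by case: mf => [/(_ _ _ x0 y0 xy)|/(_ _ _ y0 x0 xy)]; rewrite fxy ltxx.
by case: mf => [/(_ _ _ y0 x0 xy)|/(_ _ _ x0 y0 xy)]; rewrite fxy ltxx.
Qed.

Lemma strictly_monotonic_between f a b z : strictly_monotonic f -> 0 < a ->
  a <= z <= b -> Num.min (f a) (f b) <= f z <= Num.max (f a) (f b).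
Proof.
move=> mf a0 /andP[az zb].
have pos x : a <= x -> x \in `]0, +oo[.
  by move=> ax; rewrite in_itv/= andbT (lt_le_trans a0).
have aI := pos a (lexx _); have zI := pos z az;
  have bI := pos b (le_trans az zb).
rewrite ge_min le_max; case: mf => mf.
  have homo x y : x \in `]0, +oo[ -> y \in `]0, +oo[ -> x <= y -> f x <= f y.
    by move=> xI yI; rewrite le_eqVlt => /predU1P[->//|xy]; apply/ltW/mf.
  by rewrite (homo a z)// (homo z b)// orbT.
have homo x y : x \in `]0, +oo[ -> y \in `]0, +oo[ -> x <= y -> f y <= f x.
  by move=> xI yI; rewrite le_eqVlt => /predU1P[->//|xy]; apply/ltW/mf.
by rewrite (homo a z)// (homo z b)// orbT.
Qed.

Lemma wint1 f q : wint g (cst 1) f q = wmean g (f \o bary q).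
Proof. by apply: eq_wmean => t _ /=; rewrite mul1r. Qed.

(** The integral lies between the values of [f] at the two end points, because
    the weighted mean of a constant is that constant; the intermediate value
    theorem concludes. *)
Lemma wint_in_range f q : strictly_monotonic f -> smooth f -> quadrant q ->
  exists2 m, Num.min q.1 q.2 <= m <= Num.max q.1 q.2 & f m = wint g (cst 1) f q.
Proof.
move=> mf sf qq; have [q1 q2] := qq.
set a := Num.min _ _; set b := Num.max _ _.
have a0 : 0 < a by rewrite lt_min q1.
have ab : a <= b by rewrite /a /b; case: (leP q.1 q.2) => // /ltW.
have cf z : 0 < z -> {for z, continuous f} by exact: smooth_continuous.
have cfb : cont01 (f \o bary q) by exact: cont01_comp_bary.
have fb t : t \in `[0, 1] ->
    Num.min (f a) (f b) <= f (bary q t) <= Num.max (f a) (f b).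
  move=> t01; apply: strictly_monotonic_between => //; apply: bary_le => //.
    by rewrite /a /b; case: (leP q.1 q.2); rewrite lexx => // /ltW ->.
  by rewrite /a /b; case: (leP q.1 q.2); rewrite lexx ?andbT// => /ltW ->.
have [|m mab fm] :=
    @IVT _ f a b (wint g (cst 1) f q) ab (within_half_line a0 cf).
  rewrite wint1; apply/andP; split.
    rewrite -[leLHS](wmean_cst hg).
    by apply: (wmean_le hg (@cont01_cst _ _) cfb) => t /fb /andP[].
  rewrite -[leRHS](wmean_cst hg).
  by apply: (wmean_le hg cfb (@cont01_cst _ _)) => t /fb /andP[].
by exists m.
Qed.

Lemma pinv_mean f q : strictly_monotonic f -> smooth f -> quadrant q ->
  let m := 'pinv_(fun=> 1) `]0, +oo[ f (wint g (cst 1) f q) in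
  Num.min q.1 q.2 <= m <= Num.max q.1 q.2 /\ f m = wint g (cst 1) f q.
Proof.
move=> mf sf qq /=; have [m mq <-] := wint_in_range mf sf qq.
suff -> : 'pinv_(fun=> 1) `]0, +oo[ f (f m) = m by [].
apply: pinvKV; last first.
  move: qq mq; rewrite inE/= in_itv/= andbT => -[q1 q2] /andP[+ _].
  by apply: lt_le_trans; rewrite lt_min q1.
by move=> x y; rewrite !inE/=; exact: strictly_monotonic_inj.
Qed.

Lemma generates_weighted f M : strictly_monotonic f -> smooth f ->
  (forall x y : R, 0 < x -> 0 < y ->
    M (x, y) = 'pinv_(fun=> 1) `]0, +oo[ f (wmean g (f \o bary (x, y)))) ->
  generates f M.
Proof.
move=> mf sf HM [x y] qq; have [x0 y0] := qq.
have [/andP[m1 _] m2] := pinv_mean mf sf qq.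
rewrite HM// -wint1; split=> //; apply: lt_le_trans m1.
by rewrite lt_min x0.
Qed.

Lemma wint_diag p (h : R -> R) x : cont01 p ->
  wint g p h (x, x) = wmean g p * h x.
Proof.
move=> cp; rewrite mulrC -(wmeanZ hg _ cp); apply: eq_wmean => t _.
rewrite mulrC; congr (h _ * _); rewrite /bary/=; ring.
Qed.

(** Differentiate [f (M (s, x)) = wint g (cst 1) f (s, x)] in [s] once to get
    [D_1 M (x, x) = L id = 1/2], and twice to get
    [f' Q + (1/2)^2 f'' = L (t^2) f''], where [L (t^2)] is the variance plus
    1/4. *)
Lemma char_fun_generated f M x : smooth2 M -> smooth f -> generates f M ->
  0 < x -> M (x, x) = x -> derive1 f x != 0 ->
  derive1 f x * char_fun M x = wvar g * derive1 (derive1 f) x.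
Proof.
move=> sM sf gM x0 Mx fx0.
pose v := (1, 0) : R * R; pose phi (s : R) : R := M (s, x);
  pose phi1 (s : R) : R := 'D_v M (s, x).
have vin : v \in [:: (1, 0); (0, 1)] by rewrite !inE eqxx.
have dphi (s : R) : 0 < s -> is_derive s 1 phi (phi1 s).
  move=> s0; have /(_ 1%N v vin)[+ _] := sM.
  move=> /(_ (s, x) (conj s0 x0)) /derivableP; exact: is_derive_fst.
have dphi1 : is_derive x 1 phi1 (char_fun M x).
  have /(_ 2%N v vin)[_ /(_ v vin)[+ _]] := sM.
  move=> /(_ (x, x) (conj x0 x0)) /derivableP; exact: is_derive_fst.
pose p1 t := cst 1 t * bary v t; pose p2 t := p1 t * bary v t.
have c1 : cont01 p1 := cont01M (@cont01_cst R 1) (@cont01_bary R v).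
have c2 : cont01 p2 := cont01M c1 (@cont01_bary R v).
pose G s := wint g (cst 1) f (s, x).
pose G1 s := wint g p1 (derive1 f) (s, x).
have dG (s : R) : 0 < s -> is_derive s 1 G (G1 s).
  move=> s0; have qq : quadrant (s, x) by [].
  exact: (is_derive_fst (wint_is_derive hg v qq (@cont01_cst R 1) sf)).
have dG1 : is_derive x 1 G1 (wint g p2 (derive1 (derive1 f)) (x, x)).
  have qq : quadrant (x, x) by [].
  exact: (is_derive_fst (wint_is_derive hg v qq c1 (smooth_derive1 sf))).
have eG1 (s : R) : 0 < s -> derive1 f (phi s) * phi1 s = G1 s.
  move=> s0; have [phis _] := gM (s, x) (conj s0 x0).
  have d : is_derive s 1 (f \o phi) (derive1 f (phi s) * phi1 s).
    by apply: is_derive1_comp; [exact: smooth_is_derive|exact: dphi].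
  have d' : is_derive s 1 G (derive1 f (phi s) * phi1 s).
    apply: near_eq_is_derive _ d; apply: filterS (near_pos s0) => r r0.
    by have [_ ] := gM (r, x) (conj r0 x0).
  rewrite -(@derive_val _ _ _ _ _ _ _ d').
  exact: (@derive_val _ _ _ _ _ _ _ (dG s s0)).
have wp1 : wmean g p1 = 1 / 2.
  rewrite -(wmean_id hg); apply: eq_wmean => t _; rewrite /p1 /bary/=; ring.
have wp2 : wmean g p2 = wvar g + 1 / 4.
  rewrite -(wvarE hg); apply: eq_wmean => t _; rewrite /p2 /p1 /bary/=; ring.
have phix : phi x = x by [].
have phi1x : phi1 x = 1 / 2.
  by apply: (mulfI fx0); rewrite -{1}phix eG1// /G1 wint_diag// wp1 mulrC.
have [phix0 _] := gM (x, x) (conj x0 x0).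
have d : is_derive x 1 ((derive1 f \o phi) * phi1)
    (derive1 f x * char_fun M x + 1 / 4 * derive1 (derive1 f) x).
  have d1 := dphi x x0.
  have d2 : is_derive (phi x) 1 (derive1 f) (derive1 (derive1 f) x).
    by rewrite phix; exact: (smooth_is_derive (smooth_derive1 sf) x0).
  have d3 := is_derive1_comp d2 d1.
  apply: (is_derive_eq (is_deriveM d3 dphi1)).
  by rewrite /= phix phi1x /GRing.scale/=; lra.
have d' : is_derive x 1 G1
    (derive1 f x * char_fun M x + 1 / 4 * derive1 (derive1 f) x).
  apply: near_eq_is_derive _ d.
  by apply: filterS (near_pos x0) => r r0; exact: eG1.
have G1E := etrans (esym (@derive_val _ _ _ _ _ _ _ dG1))
  (@derive_val _ _ _ _ _ _ _ d').
rewrite (wint_diag _ _ c2) wp2 in G1E; move: G1E.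
move: (derive1 f x) (char_fun M x) (wvar g) (derive1 (derive1 f) x).
by move=> a b c e; lra.
Qed.

Lemma char_fun_continuous M x : smooth2 M -> 0 < x ->
  {for x, continuous (char_fun M)}.
Proof.
move=> sM x0.
have vin : ((1, 0) : R * R) \in [:: (1, 0); (0, 1)] by rewrite !inE eqxx.
have /(_ 2%N (1, 0) vin)[_ /(_ (1, 0) vin)[_ c]] := sM.
have cxx : {for x, continuous (fun z : R => (z, z))}.
  exact: (cvg_pair (@cvg_id _ (nbhs x)) (@cvg_id _ (nbhs x))).
exact: (@continuous_comp _ _ _ (fun z : R => (z, z)) _ x cxx
  (c (x, x) (conj x0 x0))).
Qed.

(** The equation extends to the zeros of [f']: if it failed at [x], it would
    fail in a neighbourhood of [x] by continuity, so [f'] would vanish on this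
    neighbourhood, and [f''] at [x]; but then it holds at [x]. *)
Lemma generator_ode f M x : smooth2 M -> smooth f -> generates f M ->
  (forall z, 0 < z -> M (z, z) = z) -> 0 < x ->
  derive1 f x * char_fun M x = wvar g * derive1 (derive1 f) x.
Proof.
move=> sM sf gM Md x0; apply/eqP; rewrite -subr_eq0; apply/negPn/negP => DN0.
pose D z := derive1 f z * char_fun M z - wvar g * derive1 (derive1 f) z.
have s1 := smooth_derive1 sf; have s2 := smooth_derive1 s1.
have cD : {for x, continuous D}.
  have cQ := char_fun_continuous sM x0.
  exact: (cvgB (cvgM (smooth_continuous s1 x0) cQ)
    (cvgM (cvg_cst (wvar g)) (smooth_continuous s2 x0))).
have nD : \forall z \near x, D z != 0 by exact: (cvgr_neq0 _ cD DN0).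
have nf : \forall z \near x, 0 = derive1 f z.
  apply: filterS2 nD (near_pos x0) => z Dz z0; apply/esym/eqP;
    apply: contraNT Dz => fz.
  by rewrite /D subr_eq0 (char_fun_generated sM sf gM z0 (Md z z0) fz).
have f1 : derive1 f x = 0 by rewrite -(nbhs_singleton nf).
have f2 : derive1 (derive1 f) x = 0.
  apply: is_derive_derive1.
  exact: near_eq_is_derive nf (is_derive_cst _ _ _).
by move: DN0; rewrite f1 f2 mul0r mulr0 subrr eqxx.
Qed.

End quasi_arithmetic.

(** * Minimality and completeness *)

Section minimal_complete.
Context {R : realType}.
Variable g : R -> R.
Hypothesis hg : symmetric_distribution g.

Lemma mean_diag (M : R * R -> R) x : is_mean M -> 0 < x -> M (x, x) = x.
Proof.
move=> [_ _ /(_ x x) + _] x0 => /(_ x0 x0); rewrite minxx maxxx => xMx.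
by apply/eqP; rewrite eq_le andbC.
Qed.

Lemma generator_exp (M : R * R -> R) (f A : R -> R) : is_mean M ->
  smooth f -> generates g f M ->
  (forall x : R, 0 < x -> is_derive x 1 A (char_fun M x / wvar g)) ->
  exists c, forall x : R, 0 < x -> derive1 f x = c * expR (A x).
Proof.
move=> mM sf gM dA; apply: linear_ode dA _ => x x0.
have [sM _ _ _] := mM.
have v0 : wvar g != 0 by rewrite gt_eqF// wvar_gt0.
rewrite mulrA (generator_ode hg sM sf gM (fun z => @mean_diag M z mM) x0).
rewrite mulrAC mulfV// mul1r.
exact: (smooth_is_derive (smooth_derive1 sf) x0).
Qed.

(** With [f1' = c1 exp A] and [f2' = c2 exp A], the function [c2 f1 - c1 f2] is
    constant, so that [c2 f1] takes the same value at both means. *)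
Lemma weighted_minimal : minimal_class (weighted_integral_mean g).
Proof.
move=> M1 M2 [mM1 [f1 [mf1 sf1 HM1]]] [mM2 [f2 [mf2 sf2 HM2]]] Q12 x y x0 y0.
have g1 : generates g f1 M1 by exact: generates_weighted.
have g2 : generates g f2 M2 by exact: generates_weighted.
have [sM1 _ _ _] := mM1.
have [|A dA] := @primitive_exists _ (fun z => char_fun M1 z / wvar g).
  by move=> z z0; apply: cvgM; [exact: char_fun_continuous|exact: cvg_cst].
have [c1 f1E] := generator_exp mM1 sf1 g1 dA.
have dA2 (z : R) : 0 < z -> is_derive z 1 A (char_fun M2 z / wvar g).
  by move=> z0; rewrite -Q12//; exact: dA.
have [c2 f2E] := generator_exp mM2 sf2 g2 dA2.
have one0 : (1 : R) \in `]0, +oo[ by rewrite in_itv/= ltr01.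
have two0 : (2 : R) \in `]0, +oo[ by rewrite in_itv/= ltr0n.
have c2N0 : c2 != 0.
  apply/eqP => c20.
  have : f2 1 = f2 2.
    apply: derive0_cst => // z z0; have := smooth_is_derive sf2 z0.
    by rewrite f2E// c20 mul0r.
  by move/(strictly_monotonic_inj mf2 one0 two0); lra.
pose h := cst c2 * f1 - cst c1 * f2.
have h0 z : 0 < z -> h z = h 1.
  move=> z0; apply: derive0_cst => // w w0.
  have d1 := smooth_is_derive sf1 w0; have d2 := smooth_is_derive sf2 w0.
  by apply: is_derive_eq; rewrite f1E// f2E// /GRing.scale/=; ring.
have hE z : 0 < z -> c2 * f1 z = c1 * f2 z + h 1.
  by move=> z0; rewrite -(h0 z z0) /h !fctE/=; ring.
have qq : quadrant (x, y) by [].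
have [M1p M1E] := g1 _ qq; have [M2p M2E] := g2 _ qq.
apply: (strictly_monotonic_inj mf1); rewrite ?in_itv/= ?andbT//.
apply: (mulfI c2N0); rewrite [RHS]hE// M1E M2E !wint1.
have cf1 : cont01 (f1 \o bary (x, y)).
  by apply: cont01_comp_bary => // z; exact: smooth_continuous.
have cf2 : cont01 (f2 \o bary (x, y)).
  by apply: cont01_comp_bary => // z; exact: smooth_continuous.
rewrite -(wmeanZ hg _ cf1) -(wmeanZ hg _ cf2) -(wmean_cst hg (h 1)).
rewrite -(wmeanD hg (cont01M (@cont01_cst _ c1) cf2) (@cont01_cst _ _)).
by apply: eq_wmean => t t01 /=; rewrite hE//; exact: bary_gt0.
Qed.

(** When [M] is generated by [f] with [f' = exp A], one has
    [D_v (e o M) = ((e' * exp (- A)) o M) * D_v (wint g (cst 1) f)]: the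
    generators below have derivatives in the algebra. *)
Inductive mean_algebra (M : R * R -> R) : (R * R -> R) -> Prop :=
| mean_algebra_wint p h : cont01 p -> smooth h -> mean_algebra M (wint g p h)
| mean_algebra_comp e : smooth e -> mean_algebra M (e \o M)
| mean_algebraD H1 H2 : mean_algebra M H1 -> mean_algebra M H2 ->
  mean_algebra M (H1 + H2)
| mean_algebraM H1 H2 : mean_algebra M H1 -> mean_algebra M H2 ->
  mean_algebra M (H1 * H2).

Lemma smooth_id : smooth (id : R -> R).
Proof.
by apply: (smooth_primitive (@smooth_cst R 1)) => x _; exact: is_derive_id.
Qed.

Lemma smooth2_generated (f A : R -> R) (M : R * R -> R) :
  strictly_monotonic f -> smooth f -> smooth A ->
  (forall x : R, 0 < x -> is_derive x 1 f (expR (A x))) ->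
  M = 'pinv_(fun=> 1) `]0, +oo[ f \o wint g (cst 1) f ->
  smooth2 M.
Proof.
move=> mf sf sA df ME.
have c1 := @cont01_cst R 1.
have Mpos q : quadrant q -> 0 < M q /\ f (M q) = wint g (cst 1) f q.
  move=> qq; have [/andP[m1 _] m2] := pinv_mean hg mf sf qq.
  rewrite ME; split=> //=; apply: lt_le_trans m1.
  by case: qq => q1 q2; rewrite lt_min q1.
have dinv q : quadrant q ->
    is_derive (wint g (cst 1) f q) 1 ('pinv_(fun=> 1) `]0, +oo[ f)
      (expR (A (M q)))^-1.
  move=> /Mpos[M0 <-]; apply: is_derive_inverse.
  - apply: filterS (near_pos M0) => z z0; apply: pinvKV.
      by move=> a b; rewrite !inE; exact: strictly_monotonic_inj.
    by rewrite inE/= in_itv/= z0.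
  - by apply: filterS (near_pos M0) => z z0; exact: smooth_continuous.
  - exact: df.
  - by rewrite gt_eqF// expR_gt0.
pose D v := wint g (fun t => cst 1 t * bary v t) (derive1 f).
have dM q v : quadrant q -> is_derive q v M (expR (- A (M q)) * D v q).
  move=> qq; rewrite expRN {1}ME; apply: is_derive_comp_along; last exact: dinv.
  exact: (wint_is_derive hg _ qq c1 sf).
have cM q : quadrant q -> {for q, continuous M}.
  move=> qq; rewrite ME; apply: continuous_comp.
    exact: (wint_continuous hg qq c1 sf).
  exact: is_derive_continuous (dinv q qq).
apply: (@smooth2_coind _ (mean_algebra M));
  last exact: mean_algebra_comp smooth_id.
move=> H; elim => {H} [p h cp sh|e se|H1 H2 _ [cH1 dH1] _ [cH2 dH2]
    |H1 H2 S1 [cH1 dH1] S2 [cH2 dH2]].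
- split=> [q qq|v]; first exact: (wint_continuous hg qq cp sh).
  exists (wint g (fun t => p t * bary v t) (derive1 h)).
    apply: mean_algebra_wint; last exact: smooth_derive1.
    exact: cont01M cp (@cont01_bary R v).
  by move=> q qq; exact: (wint_is_derive hg _ qq cp sh).
- split=> [q qq|v].
    apply: continuous_comp; first exact: cM.
    by apply: smooth_continuous => //; exact: (Mpos q qq).1.
  exists (((derive1 e * (expR \o - A)) \o M) * D v).
    apply: mean_algebraM.
      apply: mean_algebra_comp; apply: smoothM; first exact: smooth_derive1.
      by apply: smooth_exp; exact: smoothN.
    apply: mean_algebra_wint; last exact: smooth_derive1.
    exact: cont01M c1 (@cont01_bary R v).
  move=> q qq; rewrite [X in is_derive _ _ _ X](_ : _ =
      derive1 e (M q) * (expR (- A (M q)) * D v q)).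
    apply: is_derive_comp_along; first exact: dM.
    by apply: smooth_is_derive => //; exact: (Mpos q qq).1.
  by rewrite mulrA.
- split=> [q qq|v].
    by apply: cvgD; [exact: cH1|exact: cH2].
  have [K1 T1 E1] := dH1 v; have [K2 T2 E2] := dH2 v.
  exists (K1 + K2); first exact: mean_algebraD.
  by move=> q qq; apply: is_deriveD; [exact: E1|exact: E2].
- split=> [q qq|v].
    by apply: cvgM; [exact: cH1|exact: cH2].
  have [K1 T1 E1] := dH1 v; have [K2 T2 E2] := dH2 v.
  exists (H1 * K2 + H2 * K1); first by apply: mean_algebraD;
    exact: mean_algebraM.
  by move=> q qq; apply: is_deriveM; [exact: E1|exact: E2].
Qed.

(** The generator is a primitive of [exp A], where [A' = u / wvar g]. *)
Lemma weighted_complete : complete_class (weighted_integral_mean g).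
Proof.
move=> u su.
have v0 : wvar g != 0 by rewrite gt_eqF// wvar_gt0.
have sq : smooth (u * cst (wvar g)^-1) := smoothM su (@smooth_cst _ _).
have [A dA] := primitive_exists (fun x => smooth_continuous sq).
have sA : smooth A by exact: smooth_primitive sq dA.
have sE := smooth_exp sA.
have [f df] := primitive_exists (fun x => smooth_continuous sE).
have sf : smooth f by exact: smooth_primitive sE df.
have mf : strictly_monotonic f.
  left=> x y; rewrite !in_itv/= !andbT => x0 y0 xy.
  apply: (@gtr0_derive1_lt_cc _ f x y) => //; rewrite ?in_itv/= ?lexx ?ltW//.
  - move=> z; rewrite in_itv/= => /andP[xz _].
    by apply: smooth_derivable => //; exact: lt_trans xz.
  - move=> z; rewrite in_itv/= => /andP[xz _].
    by rewrite (is_derive_derive1 (df z (lt_trans x0 xz))) expR_gt0.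
  - by apply: within_half_line => // z; exact: smooth_continuous.
pose M := 'pinv_(fun=> 1) `]0, +oo[ f \o wint g (cst 1) f.
have sM : smooth2 M by exact: (smooth2_generated mf sf sA df).
have Mmean q : quadrant q -> Num.min q.1 q.2 <= M q <= Num.max q.1 q.2.
  by move=> qq; have [] := pinv_mean hg mf sf qq.
have gM : generates g f M.
  apply: generates_weighted => // x y x0 y0.
  by rewrite /M/= wint1.
have mM : is_mean M.
  split=> //.
  - by move=> x y x0 y0; have [] := gM (x, y) (conj x0 y0).
  - by move=> x y x0 y0; exact: (Mmean (x, y)).
  - move=> x y x0 y0; rewrite /M/= !wint1;
    congr ('pinv_(fun=> 1) `]0, +oo[ f _).
    rewrite -(wmean_reflect01 hg); last first.
      by apply: cont01_comp_bary => // z; exact: smooth_continuous.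
    by apply: eq_wmean => t _ /=; congr f; rewrite /bary /reflect01/=; ring.
exists M.
  split=> //; exists f; split=> // x y x0 y0.
  by rewrite /M/= wint1.
move=> x x0.
have := generator_ode hg sM sf gM (fun z => @mean_diag M z mM) x0.
have -> : derive1 (derive1 f) x = expR (A x) * (u x / wvar g).
  apply: is_derive_derive1.
  have d : is_derive x 1 (expR \o A) (expR (A x) * (u x / wvar g)).
    by apply: is_derive1_comp; exact: dA.
  apply: near_eq_is_derive _ d; apply: filterS (near_pos x0) => z z0.
  by rewrite (is_derive_derive1 (df z z0)).
rewrite (is_derive_derive1 (df x x0)) => e.
apply: (@mulfI _ (expR (A x))); first by rewrite gt_eqF// expR_gt0.
by rewrite /= in e; rewrite e; field.
Qed.

End minimal_complete.

Theorem corollary3p48 (R : realType) (g : R -> R)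
    (hg : symmetric_distribution g) :
  minimal_class (weighted_integral_mean g) /\
  complete_class (weighted_integral_mean g).
Proof. by split; [exact: weighted_minimal|exact: weighted_complete]. Qed.
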